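(* Let $N\ge2$, $1\le M<N$, $\gcd(M,N)=1$, $L\ge3$, $\sigma\in\{+,-\}$, $k\in\mathbb Z_L$, and $\eta,\eta_0\in\mathbb Z_{2N}$. Put $\chi_+=1$, $\chi_-=-1$ and $$t=\left(\frac{f_\eta}{f_{\eta_0}}\right)^{\chi_\sigma}.$$ Then $$\Gamma_k(t)^\dagger H_\eta^\sigma(M;k)\Gamma_k(t)=H_{\eta_0}^\sigma(M;k)-h_{k,k+1}+h_{k,k+1}^{[t]}.$$ Moreover, for $p=0,\dots,L-2$, with $U_p(t)=\prod_{\ell=0}^{p}\Gamma_{k+\ell}(t)^\dagger$ and $b_p=k+p \pmod L$, $$U_p(t)H_\eta^\sigma(M;k)U_p(t)^\dagger=H_{\eta_0}^\sigma(M;k)-h_{b_p,b_p+1}+h_{b_p,b_p+1}^{[t]}.$$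
   Context: Parameters: $\varepsilon=e^{i\pi/N}$, $q=\varepsilon^M$, $\omega=q^2$, $f_\eta=\varepsilon^\eta$. Endpoint space $\mathbb C^N_a$ with basis $|1\rangle,\dots,|N\rangle$ (indices mod $N$): $Z|n\rangle=\omega^n|n\rangle$, $X|n\rangle=|n+1\rangle$; $Y_{m,n}=X^mZ^n$. A physical site is $\mathbb C^2$ with basis $|0\rangle,|1\rangle$; $\sigma^+=|0\rangle\langle1|$, $\sigma^-=|1\rangle\langle0|$, $\sigma^z=\operatorname{diag}(1,-1)$. Bond density: $h_{j,j+1}=q\sigma_j^+\sigma_{j+1}^-+q^{-1}\sigma_j^-\sigma_{j+1}^++\frac{q+q^{-1}}4\sigma_j^z\sigma_{j+1}^z$. For $|t|=1$, $\Gamma(t)=\operatorname{diag}(1,t)$, $\Gamma_j(t)$ acts on site $j$, and $$h_{j,j+1}^{[t]}=\Gamma_j(t)^\dagger h_{j,j+1}\Gamma_j(t)=qt\,\sigma_j^+\sigma_{j+1}^-+q^{-1}t^{-1}\sigma_j^-\sigma_{j+1}^++\tfrac{q+q^{-1}}4\sigma_j^z\sigma_{j+1}^z.$$ In the two-spin basis $|0\rangle=|00\rangle,|1\rangle=|01\rangle,|2\rangle=|10\rangle,|3\rangle=|11\rangle$ with $E_{rc}=|r\rangle\langle c|$ (tensor signs omitted), operators on $\mathbb C^2_A\otimes\mathbb C^2_B\otimes\mathbb C^N_a$: $$\begin{aligned}S_+=\tfrac12\bigl[&-E_{01}Y_{-1,-1}+q^3E_{02}Y_{-1,0}-q^4E_{03}Y_{-2,-1}-q^2E_{10}Y_{1,1}+q^2E_{12}Y_{0,1}-qE_{13}Y_{-1,0}\\&+q^{-3}E_{20}Y_{1,0}+q^{-2}E_{21}Y_{0,-1}+q^2E_{23}Y_{-1,-1}-E_{30}Y_{2,1}-q^{-1}E_{31}Y_{1,0}+E_{32}Y_{1,1}\bigr],\\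 S_-=\tfrac12\bigl[&E_{01}Y_{-1,1}-qE_{02}Y_{-1,0}-E_{03}Y_{-2,1}+q^{-2}E_{10}Y_{1,-1}+q^2E_{12}Y_{0,-1}+q^3E_{13}Y_{-1,0}\\&-q^{-1}E_{20}Y_{1,0}+q^{-2}E_{21}Y_{0,1}-q^{-2}E_{23}Y_{-1,1}-q^{-4}E_{30}Y_{2,-1}+q^{-3}E_{31}Y_{1,0}-E_{32}Y_{1,-1}\bigr].\end{aligned}$$ Output-normalized seam: $F_+^{(\eta)}=\operatorname{diag}(1,f_\eta)$, $F_-^{(\eta)}=\operatorname{diag}(f_\eta,1)$, $S^{(\eta)}_{\sigma,ABa}=F^{(\eta)}_{\sigma,B}S_{\sigma,ABa}F^{(\eta)\dagger}_{\sigma,B}$ ($F$ on the second physical site $B$). Ring: sites labelled by $\mathbb Z_L$, Hilbert space $(\mathbb C^2)^{\otimes L}\otimes\mathbb C^N_a$, $$H_\eta^\sigma(M;k)=\sum_{j\in\mathbb Z_L,\ j\ne k-1}h_{j,j+1}+S^{(\eta)}_{\sigma,k-1,k,a},$$ subscripts indicating the ordered tensor factors acted on. *)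

(* Defs.v *)
From mathcomp Require Import all_boot all_order all_algebra.
From mathcomp Require Import complex.
From mathcomp Require mxtens.
From mathcomp Require Import reals trigo.

Set Implicit Arguments.
Unset Strict Implicit.
Unset Printing Implicit Defensive.

Import Order.TTheory GRing.Theory Num.Theory.
Local Open Scope sesquilinear_scope.
Local Open Scope ring_scope.

(* [mxtens] is not imported because its notation [_ ^t _] clashes with the
   conjugate-transpose notation [_ ^t*].  In [A *t B] the row (resp. column)
   index is i_A * n + i_B, so that the index of |ab> in C^2 (x) C^2 is 2a + b. *)
Notation "A *t B" := (@mxtens.tensmx _ _ _ _ _ A B)
  (at level 40, left associativity) : ring_scope.

Variant sign := Plus | Minus.

Definition chi (s : sign) : int := if s is Plus then 1 else -1.

Definition eps (R : realType) (N : nat) : R[i] :=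
  Complex (cos (pi / N%:R)) (sin (pi / N%:R)).

Definition qpar (R : realType) (N M : nat) : R[i] := eps R N ^+ M.

Definition omega (R : realType) (N M : nat) : R[i] := qpar R N M ^+ 2.

Definition feta (R : realType) (N : nat) (eta : 'Z_(2 * N)) : R[i] :=
  eps R N ^+ val eta.

(* Dimension of the endpoint space; equal to N when N >= 2.  Its basis is
   indexed by 'Z_N, with |N> at the index 0 (recall omega ^ N = 1). *)
Notation edim N := (Zp_trunc N).+2 (only parsing).

Definition Zend (R : realType) (N M : nat) : 'M[R[i]]_(edim N) :=
  diag_mx (\row_(n < edim N) omega R N M ^+ val n).

Definition Xend (R : realType) (N : nat) : 'M[R[i]]_(edim N) :=
  \matrix_(m < edim N, n < edim N) ((m : 'Z_N) == (n : 'Z_N) + 1)%:R.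

Definition Y (R : realType) (N M : nat) (m n : int) : 'M[R[i]]_(edim N) :=
  Xend R N ^ m * Zend R N M ^ n.

Definition sigma_p (R : realType) : 'M[R[i]]_2 := delta_mx 0 1.
Definition sigma_m (R : realType) : 'M[R[i]]_2 := delta_mx 1 0.

Definition diag2 (R : realType) (a b : R[i]) : 'M[R[i]]_2 :=
  \matrix_(i < 2, j < 2) (if i == j then if i == 0 then a else b else 0).

Definition sigma_z (R : realType) : 'M[R[i]]_2 := diag2 1 (-1).

Definition E (R : realType) (r c : nat) : 'M[R[i]]_(2 * 2) :=
  \matrix_(i < 2 * 2, j < 2 * 2) ((i == r :> nat) && (j == c :> nat))%:R.

(* Operators on C^2_A (x) C^2_B (x) C^N_a. *)
Notation seamop R N := 'M[R[i]]_(2 * 2 * edim N).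

Definition S_plus (R : realType) (N M : nat) : seamop R N :=
  let q := qpar R N M in
  let Y := Y R N M in
  let E := E R in
  2^-1 *: (
    - (E 0 1 *t Y (-1) (-1))
    + q ^+ 3 *: (E 0 2 *t Y (-1) 0)
    - q ^+ 4 *: (E 0 3 *t Y (-2) (-1))
    - q ^+ 2 *: (E 1 0 *t Y 1 1)
    + q ^+ 2 *: (E 1 2 *t Y 0 1)
    - q *: (E 1 3 *t Y (-1) 0)
    + q ^- 3 *: (E 2 0 *t Y 1 0)
    + q ^- 2 *: (E 2 1 *t Y 0 (-1))
    + q ^+ 2 *: (E 2 3 *t Y (-1) (-1))
    - (E 3 0 *t Y 2 1)
    - q^-1 *: (E 3 1 *t Y 1 0)
    + (E 3 2 *t Y 1 1)).

Definition S_minus (R : realType) (N M : nat) : seamop R N :=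
  let q := qpar R N M in
  let Y := Y R N M in
  let E := E R in
  2^-1 *: (
    (E 0 1 *t Y (-1) 1)
    - q *: (E 0 2 *t Y (-1) 0)
    - (E 0 3 *t Y (-2) 1)
    + q ^- 2 *: (E 1 0 *t Y 1 (-1))
    + q ^+ 2 *: (E 1 2 *t Y 0 (-1))
    + q ^+ 3 *: (E 1 3 *t Y (-1) 0)
    - q^-1 *: (E 2 0 *t Y 1 0)
    + q ^- 2 *: (E 2 1 *t Y 0 1)
    - q ^- 2 *: (E 2 3 *t Y (-1) 1)
    - q ^- 4 *: (E 3 0 *t Y 2 (-1))
    + q ^- 3 *: (E 3 1 *t Y 1 0)
    - (E 3 2 *t Y 1 (-1))).

Definition S_bare (R : realType) (N M : nat) (s : sign) : seamop R N :=
  if s is Plus then S_plus R N M else S_minus R N M.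

Definition F (R : realType) (N : nat) (s : sign) (eta : 'Z_(2 * N)) :
    'M[R[i]]_2 :=
  if s is Plus then diag2 1 (feta R eta) else diag2 (feta R eta) 1.

Definition on_B (R : realType) (N : nat) (A : 'M[R[i]]_2) : seamop R N :=
  (1%:M : 'M_2) *t A *t (1%:M : 'M_(edim N)).

Definition S_eta (R : realType) (N M : nat) (s : sign) (eta : 'Z_(2 * N)) :
    seamop R N :=
  on_B N (F R s eta) *m S_bare R N M s *m on_B N ((F R s eta) ^t*).

(* Basis of (C^2)^{(x) L} (x) C^N_a: a spin configuration on the sites Z_L
   together with an endpoint state.  Operators on the ring are matrices indexed
   by the enumeration of this basis. *)
Definition conf (L N : nat) : finType := ({ffun 'Z_L -> 'I_2} * 'Z_N)%type.

Notation ringop R L N := 'M[R[i]]_#|{: conf L N}|.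

Definition site_op (R : realType) (L N : nat) (j : 'Z_L) (A : 'M[R[i]]_2) :
    ringop R L N :=
  \matrix_(r, c)
    let x : conf L N := enum_val r in
    let y : conf L N := enum_val c in
    if [forall l, (l != j) ==> (x.1 l == y.1 l)] && (x.2 == y.2)
    then A (x.1 j) (y.1 j) else 0.

(* The operator acting as A on the ordered tensor factors (i, j, a). *)
Definition seam_op (R : realType) (L N : nat) (i j : 'Z_L) (A : seamop R N) :
    ringop R L N :=
  let loc (x : conf L N) : 'I_(2 * 2 * edim N) :=
    mxtens.mxtens_index (mxtens.mxtens_index (x.1 i, x.1 j), x.2) in
  \matrix_(r, c)
    let x : conf L N := enum_val r in
    let y : conf L N := enum_val c in
    if [forall l, (l != i) && (l != j) ==> (x.1 l == y.1 l)]
    then A (loc x) (loc y) else 0.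

(* The bond density h_{j,j+1}. *)
Definition h (R : realType) (L N M : nat) (j : 'Z_L) : ringop R L N :=
  let q := qpar R N M in
  q *: (site_op N j (sigma_p R) *m site_op N (j + 1) (sigma_m R))
  + q^-1 *: (site_op N j (sigma_m R) *m site_op N (j + 1) (sigma_p R))
  + ((q + q^-1) / 4) *: (site_op N j (sigma_z R) *m site_op N (j + 1) (sigma_z R)).

Definition Gamma (R : realType) (L N : nat) (j : 'Z_L) (t : R[i]) :
    ringop R L N :=
  site_op N j (diag2 1 t).

(* The twisted bond density h_{j,j+1}^{[t]}, for |t| = 1. *)
Definition h_tw (R : realType) (L N M : nat) (t : R[i]) (j : 'Z_L) :
    ringop R L N :=
  (Gamma N j t) ^t* *m h R N M j *m Gamma N j t.

Definition H (R : realType) (L N M : nat) (s : sign) (k : 'Z_L)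
    (eta : 'Z_(2 * N)) : ringop R L N :=
  \sum_(j : 'Z_L | j != k - 1) h R N M j + seam_op (k - 1) k (S_eta R M s eta).

Definition U (R : realType) (L N : nat) (k : 'Z_L) (p : nat) (t : R[i]) :
    ringop R L N :=
  \prod_(l < p.+1) (Gamma N (k + (l : nat)%:R) t) ^t*.

(* Main.v *)
Require Import Defs.
From mathcomp Require Import all_boot all_order all_algebra.
From mathcomp Require Import complex reals.
From mathcomp Require Import trigo ring.
From mathcomp Require mxtens.

Set Implicit Arguments.
Unset Strict Implicit.
Unset Printing Implicit Defensive.

Import GRing.Theory Num.Theory.
Local Open Scope sesquilinear_scope.
Local Open Scope ring_scope.

(* Conjugation by [Gamma_k(t)] only sees the operators acting on the site k:
   the seam, where it replaces [f_eta] by [f_eta0], and the bond (k, k+1), which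
   it twists.  Since a bond density conserves the total charge of its two sites,
   conjugating further by [Gamma_{b+1}(t)] untwists the bond (b, b+1) and twists
   the bond (b+1, b+2); the twist can thus travel along the ring until it meets
   the seam again. *)

(** * Phases of modulus one *)

Lemma norm_eps (R : realType) (N : nat) : `|eps R N| = 1.
Proof. by rewrite normc_def /= cos2Dsin2 sqrtr1. Qed.

Lemma norm_feta (R : realType) (N : nat) (eta : 'Z_(2 * N)) :
  `|feta R eta| = 1.
Proof. by rewrite /feta normrX norm_eps expr1n. Qed.

Lemma conj_unit (C : numClosedFieldType) (z : C) : `|z| = 1 -> z^* * z = 1.
Proof. by move=> z1; rewrite mulrC -normCK z1 expr1n. Qed.

(** * Conjugation by [Gamma], entry by entry *)

Definition phase (R : realType) (t : R[i]) (a : 'I_2) : R[i] :=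
  if a == 0 then 1 else t.

Lemma conj_phase_mul (R : realType) (t : R[i]) (a : 'I_2) :
  `|t| = 1 -> (phase t a)^* * phase t a = 1.
Proof.
by move=> t1; rewrite /phase; case: ifP; rewrite ?rmorph1 ?mulr1 ?conj_unit.
Qed.

(** A site operator only links configurations that agree away from [j]; a diagonal one forces
    agreement at [j] too. *)
Lemma Gamma_diag (R : realType) (L N : nat) (j : 'Z_L) (t : R[i]) :
  Gamma N j t
  = diag_mx (\row_r phase t ((enum_val r : conf L N).1 j)).
Proof.
apply/matrixP => r c; rewrite !mxE.
case: eqP => [->|ne_rc] /=.
  rewrite eqxx andbT; case: forallP => [_|[]]; last by move=> l; rewrite eqxx implybT.
  by rewrite mxE eqxx.
case: ifP => // /andP[/forallP agree /eqP eq2]; rewrite mxE.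
case: eqP => // eqj; case: ne_rc; apply: enum_val_inj.
move: agree eq2 eqj; case: (enum_val r) (enum_val c) => [x z] [y z'] /=.
move=> agree -> eqj; congr (_, _); apply/ffunP => l.
by case: (eqVneq l j) (agree l) => [->|_] //= /eqP.
Qed.

Lemma Gamma_adj_diag (R : realType) (L N : nat) (j : 'Z_L) (t : R[i]) :
  (Gamma N j t) ^t*
  = diag_mx (\row_r (phase t ((enum_val r : conf L N).1 j))^*).
Proof.
rewrite Gamma_diag tr_diag_mx map_diag_mx; congr diag_mx.
by apply/rowP => r; rewrite !mxE.
Qed.

Lemma Gamma_conjE (R : realType) (L N : nat) (j : 'Z_L) (t : R[i])
    (A : 'M[R[i]]_#|{: conf L N}|) r c :
  ((Gamma N j t) ^t* *m A *m Gamma N j t) r c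
  = (phase t ((enum_val r : conf L N).1 j))^* * A r c
    * phase t ((enum_val c : conf L N).1 j).
Proof. by rewrite Gamma_adj_diag Gamma_diag mul_mx_diag mul_diag_mx !mxE. Qed.

(** * Bond densities under conjugation *)

Lemma site_op_mulE (R : realType) (L N : nat) (i j : 'Z_L)
    (A B : 'M[R[i]]_2) r c : i != j ->
  let x : conf L N := enum_val r in
  let y : conf L N := enum_val c in
  (site_op N i A *m site_op N j B) r c
  = if [forall l, (l != i) && (l != j) ==> (x.1 l == y.1 l)] && (x.2 == y.2)
    then A (x.1 i) (y.1 i) * B (x.1 j) (y.1 j) else 0.
Proof.
move=> ne_ij x y; rewrite mxE.
(* The only intermediate state that can contribute: site [i] has already moved to its value in [y],
   all else is still as in [x]. *)
pose z : conf L N := ([ffun l => if l == i then y.1 l else x.1 l], x.2).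
rewrite (bigD1 (enum_rank z)) //= big1 ?addr0 => [|s ne_s]; last first.
  rewrite !mxE /=; case: ifP => [/andP[/forallP xs /eqP xs2]|]; last by rewrite mul0r.
  case: ifP => [/andP[/forallP sy /eqP sy2]|]; last by rewrite mulr0.
  case/eqP: ne_s; apply: enum_val_inj; rewrite enum_rankK.
  rewrite [LHS]surjective_pairing; congr (_, _); last by rewrite -xs2.
  apply/ffunP => l; rewrite ffunE; case: eqVneq => [->|ne_li].
    by have := sy i; rewrite ne_ij => /eqP.
  by have := xs l; rewrite ne_li => /eqP.
rewrite !mxE enum_rankK -/x -/y /= !ffunE !eqxx (eq_sym j) (negPf ne_ij) andbT.
have -> : [forall l, (l != i) ==>
    (x.1 l == [ffun l0 => if l0 == i then y.1 l0 else x.1 l0] l)].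
  by apply/forallP => l; rewrite ffunE; case: eqVneq => //= _; apply/eqP.
rewrite eq_sym.
have -> : [forall l, (l != j) ==>
    ([ffun l0 => if l0 == i then y.1 l0 else x.1 l0] l == y.1 l)]
  = [forall l, (l != i) && (l != j) ==> (x.1 l == y.1 l)].
  apply: eq_forallb => l; rewrite ffunE; case: (eqVneq l i) => //= _.
  by rewrite eqxx implybT.
by rewrite (eq_sym y.2); case: ifP => //; rewrite mulr0.
Qed.

(** True for every [L], because ['Z_L] always has at least two elements. *)
Lemma neq_succ (L : nat) (j : 'Z_L) : j != j + 1.
Proof. by rewrite -subr_eq0 opprD addNKr oppr_eq0 oner_eq0. Qed.

Definition h_loc (R : realType) (N M : nat) (a b a' b' : 'I_2) : R[i] :=
  let q := qpar R N M in
  q * (sigma_p R a a' * sigma_m R b b')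
  + q^-1 * (sigma_m R a a' * sigma_p R b b')
  + (q + q^-1) / 4 * (sigma_z R a a' * sigma_z R b b').

Lemma hE (R : realType) (L N M : nat) (j : 'Z_L) r c :
  let x : conf L N := enum_val r in
  let y : conf L N := enum_val c in
  h R N M j r c
  = if [forall l, (l != j) && (l != j + 1) ==> (x.1 l == y.1 l)]
       && (x.2 == y.2)
    then h_loc R N M (x.1 j) (x.1 (j + 1)) (y.1 j) (y.1 (j + 1)) else 0.
Proof.
have lin3 (a b d : R[i]) (A B D : ringop R L N) :
    (a *: A + b *: B + d *: D) r c = a * A r c + b * B r c + d * D r c.
  by rewrite !mxE.
rewrite /h lin3 !site_op_mulE ?neq_succ //.
by case: ifP => // _; rewrite !mulr0 !addr0.
Qed.

(** A nonzero entry of the bond has equal spins at [i] in its row and column, so the two phases are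
    conjugate and cancel. *)
Lemma Gamma_conj_h_far (R : realType) (L N M : nat) (i j : 'Z_L) (t : R[i]) :
  `|t| = 1 -> i != j -> i != j + 1 ->
  (Gamma N i t) ^t* *m h R N M j *m Gamma N i t = h R N M j.
Proof.
move=> t1 ne_ij ne_ij1; apply/matrixP => r c; rewrite Gamma_conjE hE.
case: ifP => [/andP[/forallP /(_ i)]|_]; last by rewrite mulr0 mul0r.
by rewrite ne_ij ne_ij1 /= => /eqP -> _; rewrite mulrAC conj_phase_mul ?mul1r.
Qed.

(** A nonzero entry has as many spins 1 in [(a, b)] as in [(a', b')], so each [t] meets a conjugate;
    checked on the sixteen spin values. *)
Lemma phase_h_loc (R : realType) (N M : nat) (t : R[i]) (a b a' b' : 'I_2) :
  `|t| = 1 ->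
  (phase t a)^* * (phase t b)^* * h_loc R N M a b a' b' * phase t a' * phase t b'
  = h_loc R N M a b a' b'.
Proof.
move=> t1; have tc u : t^* * u * t = u by rewrite mulrAC conj_unit ?mul1r.
rewrite /h_loc /phase /sigma_p /sigma_m /sigma_z /diag2 !mxE.
case: a b a' b' => [[|[|//]] ?] [[|[|//]] ?] [[|[|//]] ?] [[|[|//]] ?];
  rewrite -!val_eqE /= ?rmorph1 ?(mulr0, mul0r, mulr1, mul1r, addr0, add0r) //;
  by rewrite ?tc // -(mulrA t^*) !tc.
Qed.

(* Charge conservation: [h_{j,j+1}] commutes with [Gamma_j Gamma_{j+1}]. *)
Lemma Gamma_succ_conj_h_tw (R : realType) (L N M : nat) (j : 'Z_L) (t : R[i]) :
  `|t| = 1 ->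
  (Gamma N (j + 1) t) ^t* *m h_tw N M t j *m Gamma N (j + 1) t = h R N M j.
Proof.
move=> t1; apply/matrixP => r c; rewrite /h_tw !Gamma_conjE hE.
case: ifP => _; last by rewrite !(mulr0, mul0r).
by rewrite !mulrA [_^* * _^*]mulrC phase_h_loc.
Qed.

(** * The seam under conjugation *)

Lemma on_B_diag (R : realType) (N : nat) (a b : R[i]) :
  on_B N (diag2 a b)
  = diag_mx (\row_r if (mxtens.mxtens_unindex (mxtens.mxtens_unindex r).1).2 == 0
                    then a else b).
Proof.
apply/matrixP => r c.
rewrite -(mxtens.mxtens_unindexK r) -(mxtens.mxtens_unindexK c).
case: (mxtens.mxtens_unindex r) => u z; case: (mxtens.mxtens_unindex c) => v w.
rewrite -(mxtens.mxtens_unindexK u) -(mxtens.mxtens_unindexK v).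
case: (mxtens.mxtens_unindex u) => x y; case: (mxtens.mxtens_unindex v) => x' y'.
rewrite /on_B !mxtens.tensmxE !mxE !mxtens.mxtens_indexK /=.
rewrite !(inj_eq (can_inj (@mxtens.mxtens_indexK _ _)), xpair_eqE).
by do ?case: eqP => ? //=; rewrite ?(mulr0, mul0r, mulr1, mul1r).
Qed.

Lemma diag2_adj (R : realType) (a b : R[i]) :
  (diag2 a b) ^t* = diag2 a^* b^*.
Proof.
apply/matrixP => i j; rewrite !mxE eq_sym; case: eqP => [->|_].
  by case: (j == 0).
exact: conjC0.
Qed.

Lemma on_B_diag_mulE (R : realType) (N : nat) (u v u' v' : R[i])
    (A : seamop R N) (a b a' b' : 'I_2) (z z' : 'I_(Zp_trunc N).+2) :
  let r := mxtens.mxtens_index (mxtens.mxtens_index (a, b), z) in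
  let c := mxtens.mxtens_index (mxtens.mxtens_index (a', b'), z') in
  (on_B N (diag2 u v) *m A *m on_B N (diag2 u' v')) r c
  = diag2 u v b b * A r c * diag2 u' v' b' b'.
Proof.
move=> r c; rewrite !on_B_diag mul_mx_diag mul_diag_mx !mxE !eqxx.
by rewrite !mxtens.mxtens_indexK.
Qed.

(** Both factors [F] are diagonal and act on [B] alone, so each seam entry is only rescaled by a
    phase of the two [B] spins. *)
Lemma S_etaE (R : realType) (N M : nat) (s : sign) (eta : 'Z_(2 * N))
    (a b a' b' : 'I_2) (z z' : 'I_(Zp_trunc N).+2) :
  let r := mxtens.mxtens_index (mxtens.mxtens_index (a, b), z) in
  let c := mxtens.mxtens_index (mxtens.mxtens_index (a', b'), z') in
  S_eta R M s eta r c
  = F R s eta b b * S_bare R N M s r c * (F R s eta) ^t* b' b'.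
Proof.
rewrite /S_eta /F; move: (S_bare R N M s) => A.
by case: s; rewrite diag2_adj; apply: on_B_diag_mulE.
Qed.

Lemma seam_opE (R : realType) (L N : nat) (i j : 'Z_L) (A : seamop R N) r c :
  let x : conf L N := enum_val r in
  let y : conf L N := enum_val c in
  seam_op i j A r c
  = if [forall l, (l != i) && (l != j) ==> (x.1 l == y.1 l)]
    then A (mxtens.mxtens_index (mxtens.mxtens_index (x.1 i, x.1 j), x.2))
           (mxtens.mxtens_index (mxtens.mxtens_index (y.1 i, y.1 j), y.2))
    else 0.
Proof. by rewrite mxE. Qed.

Lemma Gamma_conj_seam_far (R : realType) (L N : nat) (i j l : 'Z_L) (t : R[i])
    (A : seamop R N) :
  `|t| = 1 -> l != i -> l != j ->
  (Gamma N l t) ^t* *m seam_op i j A *m Gamma N l t = seam_op i j A.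
Proof.
move=> t1 ne_li ne_lj; apply/matrixP => r c; rewrite Gamma_conjE seam_opE /=.
case: ifP => [/forallP /(_ l)|_]; last by rewrite mulr0 mul0r.
by rewrite ne_li ne_lj /= => /eqP ->; rewrite mulrAC conj_phase_mul ?mul1r.
Qed.

Lemma norm_twist (R : realType) (N : nat) (s : sign) (eta eta0 : 'Z_(2 * N)) :
  `|(feta R eta / feta R eta0) ^ chi s| = 1.
Proof.
by case: s; rewrite /chi ?expr1z ?exprN1 ?normfV normf_div !norm_feta ?divr1 ?invr1.
Qed.

(* For [Minus] the two sides differ by the phase [f_eta / f_eta0], which cancels
   between the two factors. *)
Lemma phase_F (R : realType) (N : nat) (s : sign) (eta eta0 : 'Z_(2 * N))
    (b b' : 'I_2) :
  let t := (feta R eta / feta R eta0) ^ chi s in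
  ((phase t b)^* * F R s eta b b) * ((F R s eta) ^t* b' b' * phase t b')
  = F R s eta0 b b * (F R s eta0) ^t* b' b'.
Proof.
(* On the unit circle conjugation is inversion, which turns the claim into rational identities for
   [field]. *)
have conjV (e : 'Z_(2 * N)) : (feta R e)^* = (feta R e)^-1.
  by rewrite invC_norm norm_feta expr1n invr1 mul1r.
have f_neq0 (e : 'Z_(2 * N)) : feta R e != 0.
  by rewrite -normr_eq0 norm_feta oner_eq0.
have f0 := f_neq0 eta; have f00 := f_neq0 eta0; move=> t.
rewrite {}/t /F /phase; case: s; rewrite diag2_adj /diag2 !mxE !eqxx;
  case: (b == 0); case: (b' == 0);
  rewrite ?expr1z ?exprN1 ?invf_div ?conjC1 ?fmorph_div /= ?conjV;
  move: (feta R eta) (feta R eta0) f0 f00 => f g fn gn;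
  field; by rewrite ?fn ?gn.
Qed.

Lemma Gamma_conj_seam_op (R : realType) (L N : nat) (i j : 'Z_L) (t : R[i])
    (A B : seamop R N) :
  (forall (a b a' b' : 'I_2) (z z' : 'I_(Zp_trunc N).+2),
     let r := mxtens.mxtens_index (mxtens.mxtens_index (a, b), z) in
     let c := mxtens.mxtens_index (mxtens.mxtens_index (a', b'), z') in
     (phase t b)^* * A r c * phase t b' = B r c) ->
  (Gamma N j t) ^t* *m seam_op i j A *m Gamma N j t = seam_op i j B.
Proof.
move=> AB; apply/matrixP => r c; rewrite Gamma_conjE !seam_opE /=.
by case: ifP => _; rewrite ?mulr0 ?mul0r.
Qed.

Lemma Gamma_conj_seam (R : realType) (L N M : nat) (s : sign) (i j : 'Z_L)
    (eta eta0 : 'Z_(2 * N)) :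
  let t := (feta R eta / feta R eta0) ^ chi s in
  (Gamma N j t) ^t* *m seam_op i j (S_eta R M s eta) *m Gamma N j t
  = seam_op i j (S_eta R M s eta0).
Proof.
move=> t; apply: Gamma_conj_seam_op => a b a' b' z z' r c.
rewrite !S_etaE [RHS]mulrAC -(phase_F R s eta eta0) -/t.
by rewrite !mulrA [RHS]mulrAC; congr (_ * _); rewrite mulrAC.
Qed.

(** * Moving the twist through the Hamiltonian *)

Lemma conj_GammaD (R : realType) (L N : nat) (j : 'Z_L) (t : R[i])
    (A B : ringop R L N) :
  (Gamma N j t) ^t* *m (A + B) *m Gamma N j t
  = (Gamma N j t) ^t* *m A *m Gamma N j t
    + (Gamma N j t) ^t* *m B *m Gamma N j t.
Proof. by rewrite mulmxDr mulmxDl. Qed.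

Lemma conj_Gamma_sum (R : realType) (L N : nat) (j : 'Z_L) (t : R[i])
    (P : pred 'Z_L) (A : 'Z_L -> ringop R L N) :
  (forall i, P i -> (Gamma N j t) ^t* *m A i *m Gamma N j t = A i) ->
  (Gamma N j t) ^t* *m (\sum_(i | P i) A i) *m Gamma N j t
  = \sum_(i | P i) A i.
Proof. by move=> fixA; rewrite mulmx_sumr mulmx_suml; apply: eq_bigr. Qed.

Lemma neq_of_nat (L m n : nat) : (m < L)%N -> (n < L)%N -> (2 < L)%N ->
  m != n -> (m%:R : 'Z_L) != n%:R.
Proof.
by move=> mL nL L2; rewrite -val_eqE /= !val_Zp_nat ?modn_small // ltnW.
Qed.

(** Normal form without subtraction: since [b] is not the seam bond, its plain density occurs in the
    sum and cancels. *)
Lemma H_twist (R : realType) (L N M : nat) (s : sign) (k b : 'Z_L)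
    (eta : 'Z_(2 * N)) (t : R[i]) : b != k - 1 ->
  H R M s k eta - h R N M b + h_tw N M t b
  = \sum_(j : 'Z_L | (j != k - 1) && (j != b)) h R N M j + h_tw N M t b
    + seam_op (k - 1) k (S_eta R M s eta).
Proof.
move=> ne_b; rewrite /H (bigD1 b) //=.
by rewrite -(addrA (h _ _ _ b)) (addrC (h _ _ _ b)) addrK addrAC.
Qed.

Lemma first_twist (R : realType) (L N M : nat) (s : sign) (k : 'Z_L)
    (eta eta0 : 'Z_(2 * N)) : (2 < L)%N ->
  let t := (feta R eta / feta R eta0) ^ chi s in
  (Gamma N k t) ^t* *m H R M s k eta *m Gamma N k t
  = H R M s k eta0 - h R N M k + h_tw N M t k.
Proof.
move=> L2 t; have t1 : `|t| = 1 by apply: norm_twist.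
have ne_k : k != k - 1 by rewrite -[X in X != _](subrK 1) eq_sym neq_succ.
rewrite (H_twist M s eta0 t ne_k) /H (bigD1 k ne_k) 2!conj_GammaD Gamma_conj_seam.
rewrite conj_Gamma_sum => [|j /andP[ne_jk1 ne_jk]].
  by rewrite -/(h_tw N M t k) (addrC (h_tw N M t k)).
apply: Gamma_conj_h_far => //; rewrite eq_sym //.
(* The other bond touching site [k] is [k - 1], whose place is taken by the seam. *)
by apply: contra ne_jk1 => /eqP <-; rewrite addrK.
Qed.

(** The inequalities make [b] and [b + 1] ordinary bonds and keep site [b + 1] off the seam, so
    these two bonds are all that it meets. *)
Lemma twist_step (R : realType) (L N M : nat) (s : sign) (k b : 'Z_L)
    (eta : 'Z_(2 * N)) (t : R[i]) : `|t| = 1 ->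
  b != k - 1 -> b + 1 != k - 1 -> b + 1 != k ->
  (Gamma N (b + 1) t) ^t* *m (H R M s k eta - h R N M b + h_tw N M t b)
    *m Gamma N (b + 1) t
  = H R M s k eta - h R N M (b + 1) + h_tw N M t (b + 1).
Proof.
move=> t1 ne_b ne_b1 ne_b1k; have ne_bb1 := neq_succ b.
(* The bonds away from site [b + 1], common to both sides. *)
pose T := \sum_(j : 'Z_L | [&& j != k - 1, j != b & j != b + 1]) h R N M j.
have splitL : \sum_(j : 'Z_L | (j != k - 1) && (j != b)) h R N M j
    = h R N M (b + 1) + T.
  rewrite (bigD1 (b + 1)) /=; last by rewrite ne_b1 eq_sym.
  by congr (_ + _); apply: eq_bigl => j; rewrite andbA.
have splitR : \sum_(j : 'Z_L | (j != k - 1) && (j != b + 1)) h R N M j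
    = h R N M b + T.
  rewrite (bigD1 b) /=; last by rewrite ne_b.
  by congr (_ + _); apply: eq_bigl => j; rewrite -andbA [(j != b + 1) && _]andbC.
have fixT : (Gamma N (b + 1) t) ^t* *m T *m Gamma N (b + 1) t = T.
  apply: conj_Gamma_sum => j /and3P[ne_jk1 ne_jb ne_jb1].
  apply: Gamma_conj_h_far => //; first by rewrite eq_sym.
  by rewrite (inj_eq (addIr 1)) eq_sym.
(* The plain and the twisted bond have exchanged places; this reorders them. *)
have addACA (V : zmodType) (x y z w : V) : x + y + z + w = z + y + x + w.
  by rewrite (addrC (x + y)) (addrC x) addrA.
rewrite [X in _ *m X *m _](H_twist M s eta t ne_b) splitL.
rewrite [RHS](H_twist M s eta t ne_b1) splitR.
rewrite 3!conj_GammaD fixT (Gamma_conj_seam_far _ t1 ne_b1 ne_b1k).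
rewrite (Gamma_succ_conj_h_tw N M b t1) -/(h_tw N M t (b + 1)).
exact: addACA.
Qed.

(** The product puts its newest factor on the right; diagonal factors commute, so it can become the
    outermost conjugation, as the induction requires. *)
Lemma U_succ (R : realType) (L N : nat) (k : 'Z_L) (p : nat) (t : R[i]) :
  U N k p.+1 t = (Gamma N (k + p.+1%:R) t) ^t* *m U N k p t.
Proof.
have comm (i j : 'Z_L) :
    (Gamma N i t) ^t* *m (Gamma N j t) ^t* = (Gamma N j t) ^t* *m (Gamma N i t) ^t*.
  by rewrite !Gamma_adj_diag diag_mxC.
rewrite /U big_ord_recr /=.
apply: (big_ind (fun A : ringop R L N =>
   A *m (Gamma N (k + p.+1%:R) t) ^t* = (Gamma N (k + p.+1%:R) t) ^t* *m A)).
- by rewrite mulmx1 mul1mx.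
- by move=> A B cA cB; rewrite -mulmxA cB mulmxA cA mulmxA.
- by move=> i _; exact: comm.
Qed.

Theorem theorem4p1 (R : realType) (N M L : nat)
    (hN : (2 <= N)%N) (hM1 : (1 <= M)%N) (hMN : (M < N)%N)
    (hcop : coprime M N) (hL : (3 <= L)%N)
    (s : sign) (k : 'Z_L) (eta eta0 : 'Z_(2 * N)) :
  let t : R[i] := (feta R eta / feta R eta0) ^ chi s in
  (Gamma N k t) ^t* *m H R M s k eta *m Gamma N k t
    = H R M s k eta0 - h R N M k + h_tw N M t k
  /\ forall p : nat, (p <= L - 2)%N ->
     let b : 'Z_L := k + p%:R in
     U N k p t *m H R M s k eta *m (U N k p t) ^t*
       = H R M s k eta0 - h R N M b + h_tw N M t b.
Proof.
move=> t; have tw0 := first_twist R M s k eta eta0 hL; split=> //.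
have adjM (A B : ringop R L N) : (A *m B) ^t* = B ^t* *m A ^t*.
  by rewrite trmx_mul map_mxM.
have adjK (A : ringop R L N) : A ^t* ^t* = A.
  by apply/matrixP => i j; rewrite !mxE conjCK.
elim=> [|p IHp] lt_p /=.
  (* For [p = 0] the product is the single factor at [k], already treated in [tw0]. *)
  by rewrite /U big_ord1 adjK addr0.
have := IHp (ltnW lt_p); rewrite /= U_succ adjM adjK => IH.
rewrite -!mulmxA [U _ _ _ _ *m (_ *m _)]mulmxA.
rewrite [X in _ *m X]mulmxA IH mulmxA.
have [p1L pL] : (p.+1 < L.-1)%N /\ (p < L.-1)%N.
  move: lt_p; case: (L) hL => [|[|n]] // _; rewrite !subSS subn0 /= !ltnS.
  by move=> lt_p; split=> //; apply: ltnW.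
have L1L : (L.-1 < L)%N by rewrite ltn_predL (ltn_trans _ hL).
(* As [L] vanishes in ['Z_L], the seam bond is [k + (L - 1)]. The bound [p + 1 <= L - 2] then keeps
   both bonds short of it, by comparing naturals below [L]. *)
have eq_k1 : k - 1 = k + L.-1%:R.
  congr (_ + _); apply/eqP; rewrite eq_sym -subr_eq0 opprK -mulrSr prednK ?(ltn_trans _ hL) //.
  by rewrite char_Zp // ltnW.
have ne_k n : (n < L.-1)%N -> k + n%:R != k - 1.
  move=> nL1; rewrite eq_k1 (inj_eq (addrI k)) neq_of_nat ?neq_ltn ?nL1 //.
  exact: ltn_trans L1L.
have eq_p1 : k + p.+1%:R = k + p%:R + 1 by rewrite -natr1 addrA.
rewrite eq_p1; apply: twist_step; rewrite -?eq_p1 ?ne_k ?norm_twist //.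
(* What remains is that site [k + p + 1] is not [k]: [p + 1] is nonzero modulo [L]. *)
rewrite -subr_eq0 addrAC subrr add0r (neq_of_nat (n := 0)) //; last exact: ltn_trans hL.
exact: ltn_trans L1L.
Qed.
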